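(* Let $V$ be a real locally convex topological vector space, $H$ a real Hilbert space, $j:V\to H$ a linear, weak-to-weak continuous operator, and let $\varphi: V\to\mathbb{R}\cup\{+\infty\}$ be convex, proper, lower semicontinuous and $j$-elliptic. Then the $j$-subgradient $\partial_j\varphi\subseteq H\times H$ is maximal monotone.
   Context: The effective domain of $\varphi$ is $D(\varphi)=\{\varphi<+\infty\}$; $\varphi$ is proper if $D(\varphi)\neq\emptyset$, and lower semicontinuous if all sublevels $\{\varphi\le c\}$, $c\in\mathbb{R}$, are closed in the topology of $V$. A functional on $V$ is coercive if all its sublevels $\{\cdot\le c\}$, $c\in\mathbb{R}$, are relatively weakly compact. For $\omega\in\mathbb{R}$ put $\varphi_\omega(\hat u)=\varphi(\hat u)+\frac{\omega}{2}\|j(\hat u)\|_H^2$. The functional $\varphi$ is $j$-elliptic if there exists $\omega\ge 0$ such that $\varphi_\omega$ is convex and coercive. The $j$-subgradient of $\varphi$ is the relation $$\partial_j\varphi=\Big\{(u,f)\in H\times H \;:\; \exists\,\hat u\in D(\varphi)\text{ with } j(\hat u)=u \text{ and, for every }\hat v\in V,\ \liminf_{t\searrow 0}\frac{\varphi(\hat u+t\hat v)-\varphi(\hat u)}{t}\ge\langle f,j(\hat v)\rangle_H\Big\}.$$ A relation $A\subseteq H\times H$ is monotone if $\langle f_2-f_1,u_2-u_1\rangle_H\ge 0$ for all $(u_1,f_1),(u_2,f_2)\in A$, and maximal monotone if it has no proper monotone extension in $H\times H$. *)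

(* Defs.v *)
From HB Require Import structures.
From mathcomp Require Import all_boot all_order all_algebra.
From mathcomp Require Import all_classical all_reals all_analysis.

Set Implicit Arguments.
Unset Strict Implicit.
Unset Printing Implicit Defensive.

Import Order.TTheory GRing.Theory Num.Theory.
Import numFieldNormedType.Exports.

Local Open Scope classical_set_scope.
Local Open Scope ring_scope.

(* [weak V] is a copy of [V] carrying the weak topology, i.e. the coarsest
   topology making every continuous linear functional on [V] continuous. *)
Definition weak (R : realType) (V : tvsType R) : Type := V.

Section WeakTopology.
Variables (R : realType) (V : tvsType R).

Definition weak_sup : topologicalType :=
  @sup_topology V {f : {linear V -> R^o} | continuous f}
    (fun f => Topological.class (initial_topology (sval f : V -> R^o))).

HB.instance Definition _ := Topological.copy (weak V) weak_sup.

End WeakTopology.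

Definition weak_to_weak_continuous (R : realType) (V W : tvsType R)
    (j : V -> W) : Prop :=
  continuous (j : weak V -> weak W).

Section Functionals.
Local Open Scope ereal_scope.
Variables (R : realType) (V : tvsType R).
Implicit Type phi : V -> \bar R.

Definition effective_domain phi : set V := [set u | phi u < +oo].

Definition proper_functional phi : Prop := effective_domain phi !=set0.

Definition sublevel phi (c : R) : set V := [set u | phi u <= c%:E].

Definition lsc_functional phi : Prop := forall c : R, closed (sublevel phi c).

(* At [t = 0, 1] the convention [0 * +oo = 0] makes the inequality trivial. *)
Definition convex_functional phi : Prop :=
  forall (u v : V) (t : R), (0 <= t <= 1)%R ->
    phi (t *: u + (1 - t) *: v)%R <= t%:E * phi u + (1 - t)%:E * phi v.

Definition coercive_functional phi : Prop :=
  forall c : R, compact (closure (sublevel phi c : set (weak V))).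

Variable H : normedModType R.

Definition shifted_functional (j : V -> H) phi (w : R) : V -> \bar R :=
  fun u => phi u + (w / 2 * `|j u| ^+ 2)%:E.

Definition j_elliptic (j : V -> H) phi : Prop :=
  exists w : R, [/\ (0 <= w)%R,
    convex_functional (shifted_functional j phi w) &
    coercive_functional (shifted_functional j phi w)].

Definition j_subgradient (dot : {dot H for idfun}) (j : V -> H) phi :
    set (H * H) :=
  [set uf | exists uh : V, [/\ effective_domain phi uh, j uh = uf.1 &
    forall v : V,
      (dot uf.2 (j v))%:E <=
      limf_einf (fun t : R => (t^-1)%:E * (phi (uh + t *: v)%R - phi uh))
                (0%R : R)^'+]].

End Functionals.

Section Relations.
Variables (R : realType) (H : normedModType R) (dot : {dot H for idfun}).

Definition monotone_relation (A : set (H * H)) : Prop :=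
  forall p q, A p -> A q -> 0 <= dot (q.2 - p.2) (q.1 - p.1).

Definition maximal_monotone (A : set (H * H)) : Prop :=
  monotone_relation A /\
  forall B, monotone_relation B -> A `<=` B -> B = A.

End Relations.

(* Main.v *)
Require Import Defs.
From HB Require Import structures.
From mathcomp Require Import all_boot all_order all_algebra.
From mathcomp Require Import all_classical all_reals all_analysis.
From mathcomp Require Import ring lra.
Import Order.TTheory GRing.Theory Num.Theory.
Import numFieldNormedType.Exports.

Set Implicit Arguments.
Unset Strict Implicit.
Unset Printing Implicit Defensive.

Local Open Scope classical_set_scope.
Local Open Scope ring_scope.

(** Monotonicity comes from convexity: a pair [(j u, f)] of the [j]-subgradient
    satisfies [dot f (j (w - u)) <= phi w - phi u] for every [w] of the
    effective domain ([subgradient_ineq]), and two such inequalities add up to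
    the claim.

    For maximality, Minty's argument ([Minty_maximal]) asks for a single [l > 0]
    such that [l *: id + A] is onto, [A] being the [j]-subgradient. With [w]
    given by [j]-ellipticity, any [l > w] works. Given [g], consider
      [F u = phi u + l / 2 * |j u|^2 - dot g (j u)].
    If [x] minimises [F], then comparing [F x] with [F (x + t *: v)], dividing
    by [t] and letting [t] decrease to [0] shows that
    [(j x, g - l *: j x)] belongs to [A] ([argmin_j_subgradient]).

    A minimiser exists by the direct method in the weak topology
    ([tilted_argmin_exists]). Completing a square, the sublevels of [F] are
    included in those of the shifted functional [phi + w / 2 * |j|^2], which are
    relatively weakly compact; and [F] is weakly lower semicontinuous
    ([tilted_sublevel_weakly_closed]), because [j] is weak-to-weak continuous
    and the sublevels of [phi], closed and convex, are weakly closed.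

    That last fact (Mazur, [closed_convex_weakly_closed]) rests on the
    Hahn-Banach separation of a point from a closed convex set
    ([Hahn_Banach_separation]). The analytic form
    ([Hahn_Banach_sublinear]) is obtained without extending functionals from
    subspaces: by Zorn's lemma there is a minimal sublinear function below any
    given one, and a minimal sublinear function is linear. It is applied to the
    gauge of a convex absorbing set. *)

(** * The Hahn-Banach theorem for sublinear functions *)

Definition sublinear (R : realType) (V : lmodType R) (q : V -> R) : Prop :=
  (forall x y, q (x + y) <= q x + q y) /\
  (forall (t : R) x, 0 < t -> q (t *: x) <= t * q x).

Section HahnBanach.
Context {R : realType} {V : lmodType R}.
Implicit Types (p q : V -> R) (x y : V).

Lemma sublinear0 q : sublinear q -> q 0 = 0.
Proof.
move=> [qD qZ]; have := qD 0 0; have := qZ 2^-1 0.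
by rewrite addr0 scaler0 invr_gt0 ltr0n => /(_ isT); lra.
Qed.

Lemma sublinearZ q (t : R) x : sublinear q -> 0 <= t -> q (t *: x) = t * q x.
Proof.
move=> sq; rewrite le_eqVlt => /orP[/eqP <-|t0].
  by rewrite scale0r mul0r sublinear0.
have [_ qZ] := sq; apply/eqP; rewrite eq_le qZ//=.
have := qZ t^-1 (t *: x); rewrite invr_gt0 scalerA mulVf ?gt_eqF// scale1r.
by move=> /(_ t0); rewrite ler_pdivlMl.
Qed.

Lemma sublinear_geN q x : sublinear q -> - q (- x) <= q x.
Proof.
move=> sq; have [qD _] := sq; have := qD x (- x).
by rewrite subrr sublinear0//; lra.
Qed.

(** The infimum makes [q] additive along the ray of direction [y]; the terms
    stay above [- q (- x)], by subadditivity at [t *: y = (x + t *: y) - x]. *)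
Definition flatten_along q y : V -> R :=
  fun x => inf [set q (x + t *: y) - t * q y | t in [set t : R | 0 <= t]].

Lemma flatten_along_le q y x (t : R) : sublinear q -> 0 <= t ->
  flatten_along q y x <= q (x + t *: y) - t * q y.
Proof.
move=> sq t0; apply: ge_inf; last by exists t.
exists (- q (- x)) => _ [s /= s0 <-]; have [qD _] := sq.
have := qD (x + s *: y) (- x); rewrite addrAC subrr add0r sublinearZ//; lra.
Qed.

Lemma flatten_along_ge q y x (c : R) :
  (forall t : R, 0 <= t -> c <= q (x + t *: y) - t * q y) ->
  c <= flatten_along q y x.
Proof.
move=> cq; apply: lb_le_inf; first by exists (q (x + 0 *: y) - 0 * q y), 0 => /=.
by move=> _ [t /= t0 <-]; exact: cq.
Qed.

Lemma sublinear_flatten_along q y : sublinear q ->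
  sublinear (flatten_along q y).
Proof.
move=> sq; have [qD qZ] := sq; split=> [x1 x2|t x t0].
  rewrite -lerBlDr; apply: flatten_along_ge => s s0.
  rewrite lerBlDl -lerBlDr; apply: flatten_along_ge => t t0.
  have := flatten_along_le y (x1 + x2) sq (addr_ge0 s0 t0).
  have := qD (x1 + s *: y) (x2 + t *: y).
  rewrite addrACA -scalerDl mulrDl; lra.
rewrite -ler_pdivrMl//; apply: flatten_along_ge => s s0.
rewrite ler_pdivrMl//.
have := flatten_along_le y (t *: x) sq (mulr_ge0 (ltW t0) s0).
rewrite -scalerA -scalerDr (sublinearZ _ sq (ltW t0)) -mulrA -mulrBr.
by apply: le_trans.
Qed.

Lemma flatten_along_le_id q y x : sublinear q -> flatten_along q y x <= q x.
Proof.
by move=> sq; have := flatten_along_le y x sq (lexx (0:R));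
  rewrite scale0r addr0 mul0r subr0.
Qed.

(** Replacing a minimal [q] by the flattening of [q] along [y] cannot decrease
    it, so [q x <= q (x + y) - q y]: minimality forces superadditivity. *)
Lemma minimal_sublinear_linear q : sublinear q ->
  (forall r, sublinear r -> (forall x, r x <= q x) -> r = q) ->
  linear (q : V -> R^o).
Proof.
move=> sq qmin.
have qD x y : q (x + y) = q x + q y.
  apply/eqP; rewrite eq_le; have [-> _]/= := sq.
  have := flatten_along_le y x sq ler01; rewrite scale1r mul1r.
  rewrite (qmin (flatten_along q y)); first by lra.
  - exact: sublinear_flatten_along.
  - by move=> z; exact: flatten_along_le_id.
have qN x : q (- x) = - q x.
  by have := qD x (- x); rewrite subrr sublinear0//; lra.
move=> a x y; rewrite qD; congr (_ + _).
have [a0|a0] := leP 0 a; first by rewrite sublinearZ.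
have -> : a *: x = - ((- a) *: x) by rewrite scaleNr opprK.
rewrite qN (sublinearZ _ sq) ?oppr_ge0 ?ltW// mulNr opprK.
by [].
Qed.

(** A chain of sublinear functions below [p] has its pointwise infimum as a
    lower bound, because every one of them stays above [- p (- x)]. *)
Lemma minimal_sublinear_exists p : sublinear p ->
  exists q, [/\ sublinear q, (forall x, q x <= p x) &
    forall r, sublinear r -> (forall x, r x <= q x) -> r = q].
Proof.
move=> sp; pose T := {q : V -> R | sublinear q /\ forall x, q x <= p x}.
pose below (q r : T) := `[< forall x, sval r x <= sval q x >].
have [|||A Atot|q qmin] := @Zorn T below.
- by move=> q; apply/asboolP.
- move=> q r s /asboolP qr /asboolP rs; apply/asboolP => x.
  exact: le_trans (rs x) (qr x).
- move=> [q Hq] [r Hr] /asboolP/= qr /asboolP/= rq.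
  apply/eq_exist/funext => x; apply/eqP.
  by rewrite eq_le qr rq.
- have [[q0 Aq0]|A0] := pselect (A !=set0); last first.
    by exists (exist _ p (conj sp (fun=> lexx _))) => s As; case: A0; exists s.
  pose m x := inf [set sval q x | q in A].
  have mle x (q : T) : A q -> m x <= sval q x.
    move=> Aq; apply: ge_inf; last by exists q.
    exists (- p (- x)) => _ [r _ <-]; case: r => r [sr rp] /=.
    by apply: le_trans (sublinear_geN x sr); rewrite lerN2.
  have mge x c : (forall q : T, A q -> c <= sval q x) -> c <= m x.
    move=> cA; apply: lb_le_inf; first by exists (sval q0 x), q0.
    by move=> _ [q Aq <-]; exact: cA.
  have sm : sublinear m.
    split=> [x y|t x t0].
      rewrite -lerBlDr; apply: (mge _ _) => q Aq.
      rewrite lerBlDl -lerBlDr; apply: (mge _ _) => r Ar.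
      have [s [As sq sr]] : exists s, [/\ A s, sval s x <= sval q x &
          sval s y <= sval r y].
        by have [/asboolP h|/asboolP h] := Atot q r Aq Ar;
          [exists r|exists q]; split.
      have [sD _] := (svalP s).1.
      have := mle (x + y) s As; have := sD x y; lra.
    rewrite -ler_pdivrMl//; apply: (mge _ _) => q Aq; rewrite ler_pdivrMl//.
    have [_ qZ] := (svalP q).1.
    exact: le_trans (mle _ _ Aq) (qZ _ _ t0).
  have mp x : m x <= p x by apply: le_trans (mle x q0 Aq0) ((svalP q0).2 x).
  exists (exist _ m (conj sm mp)) => q Aq; apply/asboolP => x /=; exact: mle.
exists (sval q); split; [exact: (svalP q).1|exact: (svalP q).2|].
move=> r sr rq.
have rp x : r x <= p x by apply: le_trans (rq x) ((svalP q).2 x).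
have /(_ _) := qmin (exist _ r (conj sr rp)).
by move=> <- //; apply/asboolP.
Qed.

(** Flattening [p] along [x0] first brings its value at [- x0] down to
    [- p x0]; a linear function below the flattening then equals [p] at [x0]. *)
Theorem Hahn_Banach_sublinear p x0 : sublinear p ->
  exists f : {linear V -> R^o}, (forall x, f x <= p x) /\ f x0 = p x0.
Proof.
move=> sp.
have [q [sq qp qmin]] :=
  minimal_sublinear_exists (sublinear_flatten_along x0 sp).
have lq := minimal_sublinear_linear sq qmin.
pose L := GRing.isLinear.Build R V R^o _ (q : V -> R^o) lq.
pose f : {linear V -> R^o} := HB.pack (q : V -> R^o) L.
have fp x : f x <= p x.
  exact: le_trans (qp x) (flatten_along_le_id x0 x sp).
exists f; split=> //; apply/eqP; rewrite eq_le fp/=.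
have : f (- x0) <= p (- x0 + 1 *: x0) - 1 * p x0.
  exact: le_trans (qp _) (flatten_along_le _ _ sp ler01).
by rewrite linearN scale1r addNr sublinear0// mul1r sub0r lerN2.
Qed.

End HahnBanach.

(** * Gauges and separation of convex sets *)

(** Convexity with a plain real coefficient, the form in which
    [convex_functional] provides it for sublevels. *)
Definition segment_closed (R : realType) (V : lmodType R) (A : set V) : Prop :=
  forall x y (t : R), A x -> A y -> 0 <= t <= 1 -> A (t *: x + (1 - t) *: y).

(** The Minkowski functional of [W]. *)
Definition gauge (R : realType) (V : lmodType R) (W : set V) : V -> R :=
  fun x => inf [set t : R | 0 < t /\ W (t^-1 *: x)].

Section Gauge.
Context {R : realType} {V : lmodType R} (W : set V).
Hypothesis Wconv : segment_closed W.
Hypothesis Wabs : forall x, exists2 t : R, 0 < t & W (t^-1 *: x).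

Lemma gauge_le x (t : R) : 0 < t -> W (t^-1 *: x) -> gauge W x <= t.
Proof.
by move=> t0 Wt; apply: ge_inf => //; exists 0 => s [/ltW].
Qed.

Lemma gauge_ge x (c : R) :
  (forall t : R, 0 < t -> W (t^-1 *: x) -> c <= t) -> c <= gauge W x.
Proof.
move=> cW; apply: lb_le_inf; first by have [t t0 Wt] := Wabs x; exists t.
by move=> t [t0 Wt]; exact: cW.
Qed.

(** Subadditivity: [(x + y) / (s + t)] is the convex combination of [x / s] and
    [y / t] with weights [s / (s + t)] and [t / (s + t)]. *)
Lemma sublinear_gauge : sublinear (gauge W).
Proof.
split=> [x y|a x a0].
  rewrite -lerBlDr; apply: gauge_ge => s s0 Ws.
  rewrite lerBlDl -lerBlDr; apply: gauge_ge => t t0 Wt.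
  rewrite lerBlDl; apply: gauge_le; first exact: addr_gt0.
  have st0 : s + t != 0 by rewrite gt_eqF// addr_gt0.
  have -> : (s + t)^-1 *: (x + y) =
      (s / (s + t)) *: (s^-1 *: x) + (1 - s / (s + t)) *: (t^-1 *: y).
    rewrite !scalerA scalerDr; congr (_ *: _ + _ *: _);
      by field; rewrite ?st0 ?gt_eqF.
  apply: Wconv => //; rewrite ler_pdivrMr ?addr_gt0// mul1r lerDl (ltW t0).
  by rewrite andbT divr_ge0 ?addr_ge0 ?ltW.
rewrite -ler_pdivrMl//; apply: gauge_ge => s s0 Ws.
rewrite ler_pdivrMl//; apply: gauge_le; first exact: mulr_gt0.
by rewrite scalerA invfM mulrAC mulVf ?gt_eqF// mul1r.
Qed.

Lemma gauge_le1 x : W x -> gauge W x <= 1.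
Proof. by move=> Wx; apply: gauge_le => //; rewrite invr1 scale1r. Qed.

Lemma gauge_ge1 x : ~ W x -> 1 <= gauge W x.
Proof.
move=> nWx; apply: gauge_ge => t t0 Wt; rewrite leNgt; apply/negP => t1.
apply: nWx; have W0 : W 0 by have [s _] := Wabs 0; rewrite scaler0.
have := Wconv Wt W0; move=> /(_ t); rewrite scalerA divff ?gt_eqF// scale1r.
by rewrite scaler0 addr0; apply; rewrite (ltW t0) (ltW t1).
Qed.

End Gauge.

Section Separation.
Context {R : realType} {V : tvsType R}.
Implicit Types (U C : set V) (x y : V).

Lemma tvs_cvgD T (F : set_system T) (f g : T -> V) a b : Filter F ->
  f @ F --> a -> g @ F --> b -> (fun t => f t + g t) @ F --> a + b.
Proof.
move=> FF; apply: (@continuous2_cvg T V V V F FF f g +%R a b).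
exact: (@add_continuous V (a, b)).
Qed.

Lemma tvs_cvgZ T (F : set_system T) (k : T -> R^o) (f : T -> V) (a : R) b :
  Filter F -> k @ F --> (a : R^o) -> f @ F --> b ->
  (fun t => k t *: f t) @ F --> a *: b.
Proof.
move=> FF; apply: (@continuous2_cvg T R^o V V F FF k f (fun c y => c *: y) a b).
exact: (@scale_continuous R V (a, b)).
Qed.

Lemma nbhs0_absorbing U x : nbhs (0 : V) U ->
  exists2 e : R, 0 < e & forall t : R, `|t| < e -> U (t *: x).
Proof.
move=> U0.
have : (fun t : R^o => t *: x) @ (0 : R^o) --> (0 : V).
  rewrite -[X in _ --> X](scale0r x).
  apply: tvs_cvgZ.
  - exact: cvg_id.
  - exact: cvg_cst.
move=> /(_ _ U0) /nbhs_ballP[e /= e0 eU]; exists e => // t te.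
by apply: eU; rewrite /ball/= sub0r normrN.
Qed.

Lemma nbhs_shift_scale U x (a : R) : nbhs (0 : V) U ->
  \forall y \near x, U (a *: (y - x)).
Proof.
move=> U0.
have : (fun y : V => a *: (y - x)) @ x --> (0 : V).
  rewrite -[X in _ --> X](scaler0 _ a) -(subrr x).
  apply: tvs_cvgZ.
  - exact: cvg_cst.
  - apply: tvs_cvgD.
    + exact: cvg_id.
    + exact: cvg_cst.
by move=> /(_ _ U0).
Qed.

(** A lower bound on a neighbourhood suffices: by linearity, applying it to both
    [(2 / e) *: (y - x)] and its opposite gives [|f y - f x| <= e / 2]. *)
Lemma linear_bounded_below_continuous (f : {linear V -> R^o}) U :
  nbhs (0 : V) U -> (forall u, U u -> -1 <= f u) -> continuous f.
Proof.
move=> U0 fU x; apply/cvgrPdist_lt => e e0.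
have e20 : 0 < 2 / e by rewrite divr_gt0.
near=> y.
have : U ((2 / e) *: (y - x)) by near: y; exact: nbhs_shift_scale.
have : U ((- (2 / e)) *: (y - x)) by near: y; exact: nbhs_shift_scale.
move=> /fU + /fU; rewrite !linearZ/= linearB/= -![_ *: _]/(_ * _).
rewrite mulrN mulNr => h1 h2; rewrite distrC ltr_norml.
set d : R := f y - f x in h1 h2 *.
have ed : e * (2 / e * d) = 2 * d by field; rewrite gt_eqF.
have {}h1 : -1 <= - (2 / e * d) := h1.
have {}h2 : -1 <= 2 / e * d := h2.
have {}h1 := ler_wpM2l (ltW e0) h1; have {}h2 := ler_wpM2l (ltW e0) h2.
apply/andP; split.
  by move: h2; rewrite ed; lra.
by move: h1; rewrite [e * - (_ * d)]mulrN ed; lra.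
Unshelve. all: by end_near. Qed.

Lemma nbhs0_convex U : nbhs (0 : V) U ->
  exists B, [/\ nbhs (0 : V) B, B `<=` U & segment_closed B].
Proof.
have [D Dconv [Dopen Dbasis]] := @locally_convex R V.
move=> /Dbasis [B [DB B0] BU]; exists B; split=> //.
  by apply: open_nbhs_nbhs; split => //; exact: Dopen.
move=> x y t Bx By t01.
have tP : Itv.spec (@Itv.num_sem R) (Itv.Real `[0%Z, 1%Z]) t.
  by apply/and3P; split => //; [exact: num_real| |]; case/andP: t01.
have := Dconv B (mem_set DB) x y (Itv.Def tP) (mem_set Bx) (mem_set By).
by move=> /set_mem.
Qed.

(** With [U] a convex neighbourhood of [0] such that [x + U] misses [C], the
    set [C - c0 - U] is convex, absorbing, and does not contain [x - c0]; a
    linear functional below its gauge and equal to it at [x - c0] separates.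
    The gap [d] is gained by moving from [x] inside [x + U]. *)
Theorem Hahn_Banach_separation C x : segment_closed C -> closed C ->
  C !=set0 -> ~ C x ->
  exists (f : {linear V -> R^o}) (d : R),
    [/\ continuous f, 0 < d & forall c, C c -> f c <= f x - d].
Proof.
move=> Cconv Cclosed [c0 Cc0] nCx.
have [U [U0 UC Uconv]] : exists U, [/\ nbhs (0 : V) U,
    U `<=` [set u | ~ C (x + u)] & segment_closed U].
  apply: nbhs0_convex.
  have : (fun u : V => x + u) @ (0 : V) --> x.
    rewrite -[X in _ --> X]addr0.
    apply: tvs_cvgD.
    - exact: cvg_cst.
    - exact: cvg_id.
  move=> /(_ (~` C)); apply; apply: open_nbhs_nbhs; split => //.
  by rewrite openC.
pose W := [set w : V | exists c u, [/\ C c, U u & w = c - c0 - u]].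
have Wconv : segment_closed W.
  move=> _ _ t [c1 [u1 [Cc1 Uu1 ->]]] [c2 [u2 [Cc2 Uu2 ->]]] t01.
  exists (t *: c1 + (1 - t) *: c2), (t *: u1 + (1 - t) *: u2); split.
  - exact: Cconv.
  - exact: Uconv.
  - have c0E : c0 = t *: c0 + (1 - t) *: c0 by rewrite -scalerDl subrKC scale1r.
    by rewrite [in RHS]c0E !scalerBr !opprD addrACA [X in X + _]addrACA.
have WU u : U u -> W (- u) by exists c0, u; split=> //; rewrite subrr sub0r.
have Wabs y : exists2 t : R, 0 < t & W (t^-1 *: y).
  have [e e0 eU] := nbhs0_absorbing (- y) U0.
  exists (2 / e); first by rewrite divr_gt0.
  rewrite -[_ *: _]opprK -scalerN; apply/WU/eU.
  by rewrite invf_div gtr0_norm ?divr_gt0// ltr_pdivrMr// ltr_pMr// ltr1n.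
have nWx : ~ W (x - c0).
  move=> [c [u [Cc Uu E]]]; apply: (UC _ Uu).
  suff -> : x + u = c by [].
  by move: E; rewrite addrAC => /addIr ->; rewrite subrK.
have [f [fW fx]] :=
  Hahn_Banach_sublinear (x - c0) (sublinear_gauge Wconv Wabs).
have fx1 : 1 <= f x - f c0 by rewrite -linearB fx; exact: gauge_ge1.
have fW1 w : W w -> f w <= 1 by move=> Ww; apply: le_trans (fW w) (gauge_le1 _).
have [e e0 eU] := nbhs0_absorbing (- (x - c0)) U0.
exists f, (e / 2); split.
- apply: (linear_bounded_below_continuous U0) => u /WU/fW1.
  by rewrite linearN; lra.
- by rewrite divr_gt0.
- move=> c Cc.
  have Uu : U ((e / 2) *: - (x - c0)).
    by apply: eU; rewrite gtr0_norm ?divr_gt0// ltr_pdivrMr// ltr_pMr// ltr1n.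
  have /fW1 : W (c - c0 - (e / 2) *: - (x - c0)).
    by exists c, ((e / 2) *: - (x - c0)).
  rewrite scalerN opprK linearD linearZ/= 2!linearB/= -[_ *: _]/(_ * _).
  have : e / 2 <= e / 2 * (f x - f c0) by rewrite ler_peMr// ltW// divr_gt0.
  lra.
Qed.

End Separation.

(** * Weak topology, weak compactness and lower limits *)

Section WeakTopologyTheory.
Context {R : realType} {V : tvsType R}.

Lemma linear_weak_continuous (f : {linear V -> R^o}) :
  continuous f -> continuous (f : weak V -> R^o).
Proof.
move=> fc x.
pose I := {f : {linear V -> R^o} | continuous f}.
pose i : I := exist _ f fc.
have /(cvg_sup _ _ (nbhs_filter (x : weak V))) /(_ i) xi :
  nbhs (x : weak V) --> (x : weak V) by [].
move=> A fA; apply: xi.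
exact: (@initial_continuous V R^o f x A fA).
Qed.

(** The half-space given by separation is a weak neighbourhood of [x]. *)
Theorem closed_convex_weakly_closed (C : set V) :
  segment_closed C -> closed C -> closed (C : set (weak V)).
Proof.
move=> Cconv Cclosed x Cx; apply: contrapT => nCx.
have [z [Cz _]] := Cx setT filterT.
have [f [d [fc d0 fC]]] :=
  Hahn_Banach_separation Cconv Cclosed (ex_intro _ z Cz) nCx.
have fxd : f x - d < f x by rewrite ltrBlDr ltrDl.
have [y [/fC + /=]] := Cx _ (cvgr_gt _ (@linear_weak_continuous f fc x) _ fxd).
by rewrite leNgt => /negP.
Qed.

End WeakTopologyTheory.

(** The nonempty sublevels form a filter base with a member included in a
    compact set. Each being closed, a cluster point belongs to all of them, so it
    minimises [F]; no lower bound on [F] has to be known beforehand. *)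
Lemma lsc_compact_argmin (R : realType) (T : topologicalType) (F : T -> \bar R)
    (K : R -> set T) (x0 : T) :
  (forall c : R, closed [set x | (F x <= c%:E)%E]) ->
  (forall c : R, compact (K c)) ->
  (forall c : R, [set x | (F x <= c%:E)%E] `<=` K c) ->
  (forall x, F x != -oo%E) -> (F x0 < +oo)%E ->
  exists x, forall y, (F x <= F y)%E.
Proof.
move=> Fclosed Kcompact FK Fnoo Fx0.
pose S (c : R) := [set x | (F x <= c%:E)%E].
pose D := [set c : R | S c !=set0].
have FE y : (F y < +oo)%E -> exists2 c, F y = c%:E & D c.
  have := Fnoo y; case E : (F y) => [r| |]// _ _.
  by exists r => //; exists y; rewrite /S/= E.
have [c0 Fc0 Dc0] := FE _ Fx0.
have FF : ProperFilter (filter_from D S).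
  apply: filter_from_proper; last by [].
  apply: filter_from_filter; first by exists c0.
  move=> c c' Dc Dc'; exists (Num.min c c').
    by rewrite /Num.min; case: ifP.
  move=> x; rewrite /S/= EFin_min le_min => /andP[]; by split.
have SF c : D c -> filter_from D S (S c) by exists c.
have [x [_ xF]] := Kcompact c0 _ FF (filterS (@FK c0) (SF c0 Dc0)).
exists x => y; have [/FE[c -> Dc]|] := ltP (F y) +oo%E.
  by apply: (Fclosed c) => B xB; exact: (xF _ _ (SF c Dc) xB).
by rewrite leye_eq => /eqP ->; rewrite leey.
Qed.

Section LimfEinf.
Context {R : realType} {T : choiceType} {X : filteredType T} (F : set_system X).
Implicit Types (f : X -> \bar R).

Lemma limf_einf_ge f (a : R) :
  (forall e : R, 0 < e -> F [set t | ((a - e)%:E <= f t)%E]) ->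
  (a%:E <= limf_einf f F)%E.
Proof.
move=> fF; rewrite limf_einfE; apply/lee_addgt0Pr => e e0.
rewrite -leeBlDr//; apply: le_trans (ereal_sup_ubound _); last first.
  by exists [set t | ((a - e)%:E <= f t)%E]; [exact: fF|].
by apply: le_ereal_inf_tmp => _ [t /= h <-].
Qed.

Lemma limf_einf_le f (b : \bar R) : ProperFilter F ->
  F [set t | (f t <= b)%E] -> (limf_einf f F <= b)%E.
Proof.
move=> FF fF; rewrite limf_einfE; apply: ge_ereal_sup => _ [A FA <-].
have [t [At ft]] := filter_ex (filterI FA fF).
by apply: le_trans ft; apply: ereal_inf_lbound; exists t.
Qed.

End LimfEinf.

(** * Inner products and Minty's criterion *)

Section InnerProduct.
Context {R : realType} {H : normedModType R} (dot : {dot H for idfun}).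
Hypothesis dot_norm : forall x : H, dot x x = `|x| ^+ 2.
Implicit Types x y z : H.

Lemma dotC x y : dot x y = dot y x.
Proof. by rewrite hermC expr0 mul1r. Qed.

Lemma dotDr x y z : dot x (y + z) = dot x y + dot x z.
Proof. exact: linearDr. Qed.

Lemma dotZr (a : R) x y : dot x (a *: y) = a * dot x y.
Proof. exact: linearZr_LR. Qed.

Lemma dotDl x y z : dot (y + z) x = dot y x + dot z x.
Proof. by rewrite dotC dotDr !(dotC x). Qed.

Lemma dotZl (a : R) x y : dot (a *: y) x = a * dot y x.
Proof. by rewrite dotC dotZr dotC. Qed.

Lemma dotNr x y : dot x (- y) = - dot x y.
Proof. by rewrite -scaleN1r dotZr mulN1r. Qed.

Lemma dotNl x y : dot (- y) x = - dot y x.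
Proof. by rewrite dotC dotNr dotC. Qed.

Lemma sqr_normD x y : `|x + y| ^+ 2 = `|x| ^+ 2 + 2 * dot x y + `|y| ^+ 2.
Proof.
rewrite -!dot_norm dotDl !dotDr (dotC y x); ring.
Qed.

Definition dotr x : {linear H -> R^o} := dot x.

(** With [r = (1 + |x|^2)^-1], expanding [0 <= |r x + y|^2] for [|y| <= r]
    bounds [dot x y] below by [- 1 / 2]. *)
Lemma dot_continuous x : continuous (dotr x).
Proof.
pose s := 1 + `|x| ^+ 2; have s0 : 0 < s by rewrite ltr_wpDr ?sqr_ge0.
pose r := s^-1; have r0 : 0 < r by rewrite invr_gt0.
have rs : r * s = 1 by rewrite mulVf ?gt_eqF.
apply: (@linear_bounded_below_continuous R H (dotr x) (ball 0 r)).
  exact: nbhsx_ballx.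
move=> y; rewrite -ball_normE/= sub0r normrN => /ltW yr.
rewrite /dotr/=.
have := sqr_ge0 `|r *: x + y|; rewrite sqr_normD normrZ exprMn dotZl.
rewrite (gtr0_norm r0).
have y2 : `|y| ^+ 2 <= r ^+ 2 by rewrite ler_sqr ?nnegrE// ltW.
have rr : r ^+ 2 * `|x| ^+ 2 + r ^+ 2 = r.
  by transitivity (r * (r * s)); [rewrite /s; ring|rewrite rs mulr1].
move=> h; have : 0 <= r * (1 + 2 * dot x y) by lra.
by rewrite pmulr_rge0//; lra.
Qed.

Lemma dot_weak_continuous (V : tvsType R) (j : {linear V -> H}) x :
  weak_to_weak_continuous j ->
  continuous ((fun v => dot x (j v)) : weak V -> R^o).
Proof.
move=> jc v; apply: (@continuous_comp (weak V) (weak H) R^o j (dotr x)).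
  exact: jc.
exact: (linear_weak_continuous (@dot_continuous x)).
Qed.

End InnerProduct.

(** For a pair [(u, f)] monotonically related to [A], choose [x] with
    [(x, f + l *: u - l *: x)] in [A]: monotonicity between the two pairs reads
    [0 <= - l * |u - x|^2], so that they coincide. *)
Lemma Minty_maximal (R : realType) (H : normedModType R)
    (dot : {dot H for idfun}) (dot_norm : forall x : H, dot x x = `|x| ^+ 2)
    (A : set (H * H)) (l : R) : 0 < l -> monotone_relation dot A ->
  (forall g, exists x, A (x, g - l *: x)) -> maximal_monotone dot A.
Proof.
move=> l0 Amono Aonto; split=> // B Bmono AB; apply/seteqP; split=> //.
move=> [u f] Buf; have [x Ax] := Aonto (f + l *: u).
have := Bmono _ _ (AB _ Ax) Buf => /=.
have -> : f - (f + l *: u - l *: x) = - l *: (u - x).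
  rewrite !opprD opprK addrA [f + _]addrA subrr add0r.
  by rewrite scaleNr scalerBr opprB addrC.
rewrite dotZl dot_norm mulNr oppr_ge0 pmulr_rle0//.
move=> h; have : `|u - x| ^+ 2 == 0 by rewrite eq_le h sqr_ge0.
rewrite sqrf_eq0 normr_eq0 subr_eq0 => /eqP ux.
by rewrite ux addrK in Ax *.
Qed.

(** * The j-subgradient *)

Section Subgradient.
Context {R : realType} {V : tvsType R} {H : normedModType R}.
Variable dot : {dot H for idfun}.
Hypothesis dot_norm : forall x : H, dot x x = `|x| ^+ 2.
Variables (j : {linear V -> H}) (phi : V -> \bar R).
Hypothesis j_weak : weak_to_weak_continuous j.
Hypothesis phi_noo : forall u, phi u != -oo%E.
Hypothesis phi_convex : convex_functional phi.

Lemma sublevel_segment_closed (c : R) : segment_closed (sublevel phi c).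
Proof.
move=> x y t xc yc t01; rewrite /sublevel/=.
apply: le_trans (phi_convex x y t01) _.
have [t0 t1] := andP t01.
have -> : c%:E = (t%:E * c%:E + (1 - t)%:E * c%:E)%E.
  by rewrite -!EFinM -EFinD; congr EFin; ring.
by apply: leeD; apply: lee_wpmul2l => //; rewrite lee_fin// subr_ge0.
Qed.

(** Difference quotients of a convex function are at most its increment over
    the unit step. *)
Lemma subgradient_ineq u w (a b d : R) :
  phi u = a%:E -> phi w = b%:E ->
  (d%:E <= limf_einf
     (fun t : R => (t^-1)%:E * (phi (u + t *: (w - u))%R - phi u))
     (0%R : R)^'+)%E -> d <= b - a.
Proof.
move=> ua wb dlim; rewrite -lee_fin; apply: le_trans dlim _.
apply: limf_einf_le; near=> t; rewrite /=.
have t0 : 0 < t by near: t; exact: nbhs_right_gt.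
have t1 : t < 1 by near: t; exact: nbhs_right_lt.
have := @phi_convex w u t; rewrite (ltW t0) (ltW t1) => /(_ isT).
have -> : t *: w + (1 - t) *: u = u + t *: (w - u).
  by rewrite scalerBl scale1r scalerBr addrCA.
rewrite ua wb -!EFinM -EFinD.
have := phi_noo (u + t *: (w - u)); case: (phi _) => [r| |]// _.
rewrite lee_fin => h; rewrite -EFinB -EFinM lee_fin ler_pdivrMl//; lra.
Unshelve. all: by end_near. Qed.

Lemma j_subgradient_monotone : monotone_relation dot (j_subgradient dot j phi).
Proof.
have fin u : effective_domain phi u -> exists a, phi u = a%:E.
  rewrite /effective_domain/=; have := phi_noo u.
  by case: (phi u) => [a| |]//; exists a.
move=> [_ f] [_ g] [u [/fin[a ua] /= <- hf]] [w [/fin[b wb] /= <- hg]].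
have := subgradient_ineq ua wb (hf (w - u)).
have := subgradient_ineq wb ua (hg (u - w)).
rewrite !linearB/= !dotDl !dotNl; lra.
Qed.

Hypothesis phi_lsc : lsc_functional phi.

(** Replacing [l / 2 * |j y|^2] by its tangent at [j x] leaves an affine weakly
    continuous minorant, exact at [x]. *)
Lemma tilted_sublevel_weakly_closed (l : R) (g : H) (c : R) : 0 < l ->
  closed ([set u | (phi u + (l / 2 * `|j u| ^+ 2 - dot g (j u))%:E <= c%:E)%E]
    : set (weak V)).
Proof.
move=> l0 x Cx; rewrite /= leNgt; apply/negP => cx.
pose a := l / 2 * `|j x| ^+ 2 - dot g (j x).
have [b [bx cab]] : exists b : R, (b%:E < phi x)%E /\ c - a < b.
  move: cx; rewrite -/a; have := phi_noo x; case: (phi x) => [r| |]// _.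
    rewrite lte_fin => cra; exists ((c - a + r) / 2); split; last by lra.
    by rewrite lte_fin; lra.
  by exists (c - a + 1); rewrite ltry; split=> //; lra.
have nb : nbhs (x : weak V) (~` sublevel phi b).
  apply: open_nbhs_nbhs; split.
    apply: closed_openC; apply: closed_convex_weakly_closed => //.
    exact: sublevel_segment_closed.
  by rewrite /sublevel/= => bx'; move: bx; rewrite ltNge bx'.
pose h := l *: j x - g.
have hc := @dot_weak_continuous _ _ dot dot_norm V j h j_weak x.
have nh := cvgr_gt _ hc (dot h (j x) + (c - a - b)).
have /Cx[y [/= yc [/= yb yh]]] := filterI nb (nh _ ltac:(lra)).
have {}yb : (b%:E < phi y)%E by rewrite ltNge; apply/negP.
have sq : 2 * dot (j x) (j y) <= `|j x| ^+ 2 + `|j y| ^+ 2.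
  have := sqr_ge0 `|j y - j x|.
  rewrite (sqr_normD dot_norm) normrN dotNr (dotC dot (j y)); lra.
have tangent : c - b < l / 2 * `|j y| ^+ 2 - dot g (j y).
  move: yh; rewrite /h !dotDl !dotNl !dotZl (dot_norm (j x)) /a.
  have : 0 <= l * (`|j x| ^+ 2 + `|j y| ^+ 2 - 2 * dot (j x) (j y)).
    by rewrite mulr_ge0 ?subr_ge0// ltW.
  lra.
move: yc; rewrite leNgt => /negP; apply.
have -> : c = b + (c - b) by ring.
by rewrite EFinD lteD// lte_fin.
Qed.

Hypothesis phi_proper : proper_functional phi.

(** The excess [(l - w) / 2 * |j u|^2] absorbs the linear term [dot g (j u)],
    so the sublevels lie in those of the coercive shifted functional. *)
Lemma tilted_argmin_exists (w l : R) (g : H) :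
  coercive_functional (shifted_functional j phi w) -> 0 < l -> w < l ->
  exists2 x, effective_domain phi x & forall y,
    (phi x + (l / 2 * `|j x| ^+ 2 - dot g (j x))%:E <=
     phi y + (l / 2 * `|j y| ^+ 2 - dot g (j y))%:E)%E.
Proof.
move=> coer l0 wl; have [x0 Dx0] := phi_proper.
pose k := (l - w)^-1; have lw0 : 0 < l - w by rewrite subr_gt0.
have k0 : 0 < k by rewrite invr_gt0.
pose S c := sublevel (shifted_functional j phi w) (c + k / 2 * `|g| ^+ 2).
pose K c := closure (S c : set (weak V)).
pose F u := (phi u + (l / 2 * `|j u| ^+ 2 - dot g (j u))%:E)%E.
have Ffin u : (F u < +oo)%E = (phi u < +oo)%E.
  by rewrite /F; case: (phi u) => [r| |]//; rewrite -EFinD !ltry.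
have [||c u|u||x xmin] := @lsc_compact_argmin R (weak V) F K x0.
- by move=> c; exact: tilted_sublevel_weakly_closed.
- by move=> c; exact: coer.
- rewrite /= => Fu; apply: subset_closure.
  rewrite /S /sublevel/shifted_functional/=.
  have sq : dot g (j u) <= (l - w) / 2 * `|j u| ^+ 2 + k / 2 * `|g| ^+ 2.
    have := sqr_ge0 `|(l - w) *: j u - g|.
    rewrite (sqr_normD dot_norm) normrN dotNr dotZl (dotC dot (j u)) normrZ.
    rewrite exprMn (gtr0_norm lw0).
    set E := (X in 0 <= X) => E0; have : 0 <= k * E by rewrite mulr_ge0// ltW.
    have -> : k * E =
        (l - w) * `|j u| ^+ 2 - 2 * dot g (j u) + k * `|g| ^+ 2.
      by rewrite /E /k; field; rewrite gt_eqF.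
    lra.
  move: Fu; rewrite /F; have := phi_noo u; case: (phi u) => [r| |]// _.
  rewrite -!EFinD !lee_fin; lra.
- by rewrite /F; have := phi_noo u; case: (phi u).
- by rewrite Ffin.
exists x => //.
by rewrite /effective_domain/= -Ffin (le_lt_trans (xmin x0))// Ffin.
Qed.

(** Along [x + t *: v] the quadratic part of the minimised functional has
    derivative [dot (l *: j x - g) (j v)] at [0]; its difference quotient differs
    from that by [t * (l / 2 * |j v|^2)], which tends to [0]. *)
Lemma argmin_j_subgradient (l : R) (g : H) x : effective_domain phi x ->
  (forall y, (phi x + (l / 2 * `|j x| ^+ 2 - dot g (j x))%:E <=
     phi y + (l / 2 * `|j y| ^+ 2 - dot g (j y))%:E)%E) ->
  0 < l -> j_subgradient dot j phi (j x, g - l *: j x).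
Proof.
move=> Dx xmin l0; exists x; split=> //= v.
have [a xa] : exists a, phi x = a%:E.
  by move: Dx; rewrite /effective_domain/=; have := phi_noo x;
    case: (phi x) => [r| |]//; exists r.
apply: limf_einf_ge => e e0.
pose q := l / 2 * `|j v| ^+ 2.
have q0 : 0 <= q by rewrite mulr_ge0 ?divr_ge0 ?sqr_ge0 ?ltW.
have eq0 : 0 < e / (q + 1) by rewrite divr_gt0// ltr_wpDl.
near=> t; rewrite /=.
have t0 : 0 < t by near: t; exact: nbhs_right_gt.
have te : t < e / (q + 1) by near: t; exact: nbhs_right_lt.
have := xmin (x + t *: v).
rewrite xa; have := phi_noo (x + t *: v).
case: (phi _) => [r| |]// _; last first.
  by move=> _; rewrite addye// gt0_muley ?leey// lte_fin invr_gt0.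
rewrite -!EFinD -EFinM !lee_fin ler_pdivlMl//.
rewrite linearD linearZ/= (sqr_normD dot_norm) !dotDr !dotZr normrZ exprMn.
rewrite (gtr0_norm t0) dotDl dotNl dotZl.
move: te; rewrite ltr_pdivlMr ?ltr_wpDl// => te.
have : t * (t * (q + 1)) <= t * e by rewrite ler_wpM2l// ltW.
have : 0 <= t * t by rewrite mulr_ge0// ltW.
rewrite /q; set X := dot _ _; lra.
Unshelve. all: by end_near. Qed.

End Subgradient.

(* The real Hilbert space H is a complete normed space together with an inner
   product inducing its norm. *)
Theorem theorem2p6 (R : realType) (V : tvsType R)
    (H : completeNormedModType R) (dot : {dot H for idfun})
    (dot_norm : forall x : H, dot x x = `|x| ^+ 2)
    (j : {linear V -> H}) (j_weak : weak_to_weak_continuous j)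
    (phi : V -> \bar R) (phi_noo : forall u : V, phi u != -oo%E)
    (phi_convex : convex_functional phi)
    (phi_proper : proper_functional phi)
    (phi_lsc : lsc_functional phi)
    (phi_elliptic : j_elliptic j phi) :
  maximal_monotone dot (j_subgradient dot j phi).
Proof.
have [w [w0 _ coer]] := phi_elliptic.
have wl : w < w + 1 by rewrite ltrDl.
have l0 : 0 < w + 1 by exact: le_lt_trans wl.
apply: (Minty_maximal dot_norm l0); first exact: j_subgradient_monotone.
move=> g; have [x Dx xmin] := tilted_argmin_exists dot_norm j_weak phi_noo
  phi_convex phi_lsc phi_proper g coer l0 wl.
by exists (j x); exact: (argmin_j_subgradient dot_norm phi_noo Dx xmin l0).
Qed.
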